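(* Let $G$ be a finite abelian group of order $n$, $\mathrm{Irr}(G)=\{\chi_1,\ldots,\chi_n\}$, where $\chi_1$ is the trivial character of $G$, and let $\Gamma=\mathrm{SC}(G,R,R,S)$. For each $i$ put $\lambda_i^+=\chi_i(R)+|\chi_i(S)|$ and $\lambda_i^-=\chi_i(R)-|\chi_i(S)|$. Let $u=(g,r)$ and $v=(h,s)$ be vertices of $\Gamma$ and $a=g^{-1}h$. If $r=s$, then $\Gamma$ has a PST between two distinct vertices $u$ and $v$ if and only if the following conditions hold: (i) $a$ has order $2$; (ii) $\Gamma$ is integral, and for each $i$, $\chi_i(R)$ and $|\chi_i(S)|$ are integers; (iii) $\nu_2(|R|+|S|-\lambda_i^+)=\nu_2(|R|+|S|-\lambda_i^-)$ is the same integer, say $k$, for all $i$ such that $\chi_i(a)=-1$, and for all $i$ with $\chi_i(a)=1$, $\nu_2(|R|+|S|-\lambda_i^+)>k$ and $\nu_2(|R|+|S|-\lambda_i^-)>k$. Also, $\Gamma$ is periodic if and only if $\Gamma$ is integral. Furthermore, the minimum period of the vertices is $\frac{2\pi}{M}$, where $M=\gcd\{\lambda-\lambda_1^+\mid \lambda\in\mathrm{Spec}(\Gamma)\setminus\{\lambda_1^+\}\}$.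
   Context: Here $\mathbf{i}=\sqrt{-1}$. Graphs are finite, simple and undirected. Semi-Cayley graph: let $G$ be a finite group and $R,L,S\subseteq G$ with $R=R^{-1}$, $L=L^{-1}$ and $1\notin R\cup L$. $\mathrm{SC}(G,R,L,S)$ is the undirected graph with vertex set $\{(g,0),(g,1)\mid g\in G\}$ and edges $\{(x,0),(y,0)\}$ with $yx^{-1}\in R$, $\{(x,1),(y,1)\}$ with $yx^{-1}\in L$, and $\{(x,0),(y,1)\}$ with $yx^{-1}\in S$. PST and periodicity: for a graph with adjacency matrix $A$, put $H(t)=\exp(-\mathbf{i}tA)$ for real $t>0$. The graph has a perfect state transfer (PST) from $u$ to $v$ at time $t$ if $|H_{u,v}(t)|=1$ (this is symmetric in $u,v$); it has a PST between $u$ and $v$ if this holds for some $t>0$. It is periodic at $u$ with period $t$ if $|H_{u,u}(t)|=1$, and it is called periodic if it is periodic at all vertices with a common period $t$. A graph is integral if all eigenvalues of its adjacency matrix are integers; $\mathrm{Spec}(\Gamma)$ is the set of eigenvalues of the adjacency matrix (for $\Gamma=\mathrm{SC}(G,R,R,S)$ with $G$ abelian these are the $\lambda_i^{\pm}$, and $\lambda_1^+=|R|+|S|$). $\mathrm{Irr}(G)$ is the set of complex irreducible characters of $G$; $\chi(Y)=\sum_{y\in Y}\chi(y)$ for $Y\subseteq G$, with $\chi(\emptyset)=0$. $\nu_2:\mathbb{Q}\to\mathbb{Z}\cup\{\infty\}$ is the $2$-adic valuation: $\nu_2(0)=\infty$, $\nu_2(2^l\frac{p}{q})=l$ for $l,p,q\in\mathbb{Z}$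 with $p,q$ odd; $\infty>l$ for all $l\in\mathbb{Z}$. *)

(* Defs.v *)
From HB Require Import structures.
From mathcomp Require Import all_boot all_order all_algebra all_fingroup.
From mathcomp Require Import all_field all_character complex.
From mathcomp Require Import boolp classical_sets fsbigop reals.
From mathcomp Require Import constructive_ereal topology normedtype sequences.

Set Implicit Arguments.
Unset Strict Implicit.
Unset Printing Implicit Defensive.

Import Order.TTheory GRing.Theory Num.Theory numFieldNormedType.Exports.
Local Open Scope ring_scope.
Local Open Scope complex_scope.

(* A graph is given by its edge relation on a finite vertex type. Copy 0 of the
   group is labelled false, copy 1 is labelled true. Here {(x,0),(y,1)} is an
   edge iff y x^-1 is in S, whichever endpoint comes first. *)
Definition semi_cayley (gT : finGroupType) (R L S : {set gT}) :
    rel (gT * bool) := fun u v =>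
  match u.2, v.2 with
  | false, false => (v.1 * u.1^-1)%g \in R
  | true, true => (v.1 * u.1^-1)%g \in L
  | false, true => (v.1 * u.1^-1)%g \in S
  | true, false => (u.1 * v.1^-1)%g \in S
  end.

Lemma semi_cayley_irrefl (gT : finGroupType) (R L S : {set gT}) :
  1%g \notin R :|: L -> irreflexive (semi_cayley R L S).
Proof.
rewrite inE negb_or => /andP[/negbTE R1 /negbTE L1] [x []];
  by rewrite /semi_cayley /= mulgV.
Qed.

Lemma semi_cayley_sym (gT : finGroupType) (R L S : {set gT}) :
  R^-1%g = R -> L^-1%g = L -> symmetric (semi_cayley R L S).
Proof.
move=> RV LV [x r] [y s]; rewrite /semi_cayley /=; case: r; case: s => //.
  by rewrite -{1}LV inE invMg invgK.
by rewrite -{1}RV inE invMg invgK.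
Qed.

Definition adjmx (F : nzRingType) (V : finType) (e : rel V) : 'M[F]_#|V| :=
  \matrix_(i, j) (e (enum_val i) (enum_val j))%:R.
Arguments adjmx {F V} e.

(* The regular algebra (K[i])^o is K[i] with the topology of its norm. *)
Definition expmx (K : realType) (n : nat) (A : 'M[K[i]]_n) : 'M[K[i]]_n :=
  \matrix_(i, j)
    limn (series (fun k : nat => (k`!%:R^-1 *: A ^+ k) i j : (K[i])^o)).

Section Graph.
Variables (K : realType) (V : finType) (e : rel V).

Definition transition (t : K) (u v : V) : K[i] :=
  expmx ((- ('i * t%:C)) *: adjmx e) (enum_rank u) (enum_rank v).

Definition pst_at (t : K) (u v : V) : Prop := `|transition t u v| = 1.

Definition pst (u v : V) : Prop := exists2 t : K, 0 < t & pst_at t u v.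

Definition periodic_at (t : K) (u : V) : Prop := `|transition t u u| = 1.

Definition periodic_graph : Prop :=
  exists2 t : K, 0 < t & forall u : V, periodic_at t u.

Definition minimum_period (T : K) (u : V) : Prop :=
  [/\ 0 < T, periodic_at T u &
      forall t : K, 0 < t -> periodic_at t u -> T <= t].

Definition spectrum : set K[i] := [set l | eigenvalue (adjmx e) l]%classic.

Definition integral_graph : Prop :=
  forall l : K[i], spectrum l -> exists z : int, l = z%:~R.

End Graph.

(* gcd of the integers l - l0 with l in A; gcdn ignores signs, and the set of
   these integers is finite when A is, in particular when A is a spectrum. *)
Definition gcd_diff (K : realType) (A : set K[i]) (l0 : K[i]) : nat :=
  \big[gcdn/0%N]_(z \in [set z : int | exists2 l, A l & l - l0 = z%:~R]%classic)
    `|z|%N.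

(* Irr(G) is indexed by Iirr G, with 'chi_0 the trivial character. *)
Definition charsum (gT : finGroupType) (i : Iirr [set: gT]) (Y : {set gT}) :
  algC := \sum_(y in Y) 'chi_i y.

Definition lambda_plus (gT : finGroupType) (R S : {set gT})
  (i : Iirr [set: gT]) : algC := charsum i R + `|charsum i S|.

Definition lambda_minus (gT : finGroupType) (R S : {set gT})
  (i : Iirr [set: gT]) : algC := charsum i R - `|charsum i S|.

Definition nu2 (q : rat) : \bar int :=
  if q == 0 then +oo%E
  else ((logn 2 `|numq q|%N)%:Z - (logn 2 `|denq q|%N)%:Z)%:E%E.

(* Meaningful on algebraic numbers that are rational. *)
Definition nu2C (z : algC) : \bar int := nu2 (getCrat z).

(* Main.v *)
Require Import Defs.
From HB Require Import structures.
From mathcomp Require Import all_boot all_order all_algebra all_fingroup.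
From mathcomp Require Import all_solvable all_field all_character complex.
From mathcomp Require Import boolp classical_sets cardinality fsbigop reals.
From mathcomp Require Import constructive_ereal topology normedtype sequences.
From mathcomp Require Import trigo zify ring lra.

Set Implicit Arguments.
Unset Strict Implicit.
Unset Printing Implicit Defensive.

Import Order.TTheory GRing.Theory Num.Theory numFieldNormedType.Exports.
Local Open Scope ring_scope.

(** The characters chi_i of G take values in a cyclotomic field; sending a
    generator of that field to a root in K[i] of its minimal polynomial gives
    homomorphisms psi_i : G -> K[i] satisfying the same rational relations.
    With e_i the phase of the conjugate of psi_i(S), the vectors
    (psi_i, e_i psi_i) and (psi_i, - e_i psi_i) form an orthogonal eigenbasis
    of the adjacency matrix for the real eigenvalues psi_i(R) + |psi_i(S)| and
    psi_i(R) - |psi_i(S)|. Hence H(t) at ((g, r), (h, r)) is the mean of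
    exp(- i t l) conj(psi_i(a)) over all these eigenvalues l, where a = g^-1 h,
    and it has modulus 1 iff these unit numbers are all equal, that is, iff
    exp(i t (d - l)) = psi_i(a) for every l, with d = |R| + |S|.

    If this holds for some t > 0, raising to the order of a shows that all
    d - l are integer multiples of one real c; since the trace vanishes, the
    d - l add up to 2|G|d, so c and all l are rational. Then the algebraic
    integers chi_i(R) and |chi_i(S)| are integers. As conjugate characters
    share their eigenvalues, psi_i(a) is 1 or -1, so t (d - l) is an even or an
    odd multiple of pi; comparing 2-adic valuations gives (iii), and conversely
    t = pi / 2^k works. *)

(** * Transporting characters from [algC] to another closed field *)

Lemma minimal_poly_irreducible (z : algC) (p : {poly rat}) :
  p != 0 ->
  (forall q, root (map_poly ratr q) z = (p %| q)) -> irreducible_poly p.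
Proof.
move=> p0 dv_p.
have pz : root (map_poly ratr p) z by rewrite dv_p dvdpp.
by apply/(subfx_irreducibleP pz p0) => q qz q0; rewrite dvdp_leq // -dv_p.
Qed.

(** Take for [w] a root in [C] of the minimal polynomial [p] of [z]. A polynomial vanishing at [w]
    shares a root with the irreducible [p], so it is not coprime to [p], and [p] divides it. *)
Lemma conjugate_root_exists (C : numClosedFieldType) (z : algC) :
  exists w : C, forall q : {poly rat},
    root (map_poly ratr q) w = root (map_poly ratr q) z.
Proof.
have [p [_ mon_p] dv_p] := minCpolyP z.
have irr_p := minimal_poly_irreducible (monic_neq0 mon_p) dv_p.
have [w pw] : exists w : C, root (map_poly ratr p) w.
  apply/closed_rootP; rewrite size_map_poly.
  by case: irr_p => p1 _; rewrite neq_ltn p1 orbT.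
exists w => q; rewrite dv_p; apply/idP/idP => [qw|/dvdpP[r ->]]; last first.
  by rewrite rmorphM rootM pw orbT.
apply: contraLR qw => pq.
have : coprimep p q by rewrite irreducible_poly_coprime //.
by rewrite -(coprimep_map (@ratr C)) => /coprimep_root; apply.
Qed.

(** All values of all characters are powers of one primitive root of unity [z]. Replacing [z] by [w]
    keeps every polynomial relation with rational coefficients, and each property is derived from
    such a relation. *)
Lemma conjugate_characters (C : numClosedFieldType) (gT : finGroupType) :
  abelian [set: gT] ->
  exists psi : Iirr [set: gT] -> gT -> C,
  [/\ forall i x y, psi i (x * y)%g = psi i x * psi i y,
      (forall i x, `|psi i x| = 1) /\
      (forall i x, psi (conjC_Iirr i) x = (psi i x)^*),
      forall x, \sum_i psi i x = (#|gT| * (x == 1%g))%:R,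
      forall i (Y : {set gT}) (q : rat),
        (\sum_(y in Y) psi i y == ratr q) = (charsum i Y == ratr q)
    & forall i (Y : {set gT}) (q : rat),
        (`|\sum_(y in Y) psi i y| == ratr q) = (`|charsum i Y| == ratr q)].
Proof.
move=> abG; pose m := #|gT|.
have lin i := char_abelianP _ abG i.
have m0 : (0 < m)%N by rewrite /m -cardsT cardG_gt0.
have [z z_prim] := C_prim_root_exists m0.
have [w zw] := conjugate_root_exists C z.
have chi_m i x : 'chi[[set: gT]]_i x ^+ m = 1.
  rewrite -lin_charX ?inE // /m -cardsT expg_cardG ?inE //.
  by rewrite lin_char1.
pose e i x := sval (prim_rootP z_prim (chi_m i x)).
have chiE i x : 'chi_i x = z ^+ e i x.
  by rewrite /e; case: (prim_rootP _ _) => j /= ->.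
pose psi i x := w ^+ e i x.
have tr (p : {poly rat}) :
    ((map_poly ratr p).[w] == 0) = ((map_poly ratr p).[z] == 0).
  exact: zw.
have psi_m i x : psi i x ^+ m = 1.
  apply/eqP; rewrite -subr_eq0.
  have := tr ('X^(e i x * m) - 1); rewrite !(rmorphB, rmorph1) /=.
  rewrite !map_polyXn !(hornerE, hornerXn) !exprM => ->.
  by rewrite -chiE chi_m subrr.
have psi_norm i x : `|psi i x| = 1.
  by apply/eqP; rewrite -(@pexpr_eq1 _ _ m) // -normrX psi_m normr1.
have psi_conj i x : psi (conjC_Iirr i) x = (psi i x)^*.
  have p0 : psi i x != 0 by rewrite -normr_gt0 psi_norm ltr01.
  apply: (mulIf p0); rewrite [RHS]mulrC -normCK psi_norm expr1n.
  apply/eqP; rewrite -subr_eq0.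
  have := tr ('X^(e (conjC_Iirr i) x) * 'X^(e i x) - 1).
  rewrite !(rmorphB, rmorphM, rmorph1) /= !map_polyXn.
  rewrite !(hornerE, hornerXn) => ->.
  rewrite -!chiE conjC_IirrE cfunE [_ * 'chi_i x]mulrC -normCK.
  by rewrite normC_lin_char ?inE // expr1n subrr.
pose P i (Y : {set gT}) : {poly rat} := \sum_(y in Y) 'X^(e i y).
have PE (F : numClosedFieldType) (v : F) i Y :
    (map_poly ratr (P i Y)).[v] = \sum_(y in Y) v ^+ e i y.
  rewrite /P rmorph_sum horner_sum; apply: eq_bigr => y _.
  by rewrite /= map_polyXn hornerXn.
have Pz i Y : (map_poly ratr (P i Y)).[z] = charsum i Y.
  by rewrite PE; apply: eq_bigr => y _; rewrite chiE.
have Pw i Y : (map_poly ratr (P i Y)).[w] = \sum_(y in Y) psi i y by rewrite PE.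
exists psi; split => [i x y||x|i Y q|i Y q].
- apply/eqP; rewrite -subr_eq0.
  have := tr ('X^(e i (x * y)%g) - 'X^(e i x) * 'X^(e i y)).
  rewrite !(rmorphB, rmorphM, rmorph1) /= !map_polyXn.
  rewrite !(hornerE, hornerXn) => ->.
  by rewrite -!chiE lin_charM ?inE // subrr.
- by split.
- apply/eqP; rewrite -subr_eq0.
  have := tr (\sum_i 'X^(e i x) - (m * (x == 1%g))%:R).
  rewrite !(rmorphB, rmorph_sum, rmorph_nat) /= !hornerE !horner_sum.
  rewrite -!polyC_natr !hornerC.
  rewrite (eq_bigr (psi^~ x)) => [->|i _]; last by rewrite map_polyXn hornerXn.
  rewrite (eq_bigr (fun i => 'chi_i x)) => [|i _]; last first.
    by rewrite map_polyXn hornerXn -chiE.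
  (* Second orthogonality against the column of the identity, where every linear character is 1. *)
  have -> : \sum_i 'chi[[set: gT]]_i x =
      #|'C_[set: gT][x]%g|%:R *+ (x \in (1%g ^: [set: gT])%g).
    rewrite -(second_orthogonality_relation x (finset.in_setT 1%g)).
    apply: eq_bigr => i _.
    by rewrite (lin_char1 (lin i)) rmorph1 mulr1.
  rewrite class1G inE natrM -mulr_natr.
  have -> : ('C_[set: gT][x])%g = [set: gT].
    by apply/finset.setIidPl; rewrite sub_cent1 (fintype.subsetP abG) ?inE.
  by rewrite cardsT subrr.
- have := tr (P i Y - q%:P).
  by rewrite !rmorphB /= !map_polyC !hornerE /= Pz Pw !subr_eq0.
(* The square of the modulus, unlike the modulus, is polynomial in [z]: it is the product with the
   sum over the conjugate character. *)
- have := tr (P i Y * P (conjC_Iirr i) Y - (q * q)%:P).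
  rewrite !rmorphB !rmorphM /= !map_polyC !(hornerD, hornerN, hornerM, hornerC).
  rewrite /= !Pz !Pw.
  have -> : \sum_(y in Y) psi (conjC_Iirr i) y = (\sum_(y in Y) psi i y)^*.
    by rewrite rmorph_sum; apply: eq_bigr.
  have -> : charsum (conjC_Iirr i) Y = (charsum i Y)^*.
    by rewrite rmorph_sum; apply: eq_bigr => y _; rewrite conjC_IirrE cfunE.
  rewrite -!normCK !subr_eq0.
  (* Comparing squares is enough for [q >= 0]; for negative [q] both sides are false. *)
  have [q0|q0] := leP 0 q; first by rewrite !eqrXn2 ?ler0q.
  by move=> _; rewrite !gt_eqF // (lt_le_trans _ (normr_ge0 _)) // ltrq0.
Qed.

(** * Eigenvectors and spectral decomposition of the adjacency matrix *)

Section Spectral.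
Variables (C : numClosedFieldType) (gT : finGroupType) (I : finType).
Variables (psi : I -> gT -> C) (R S : {set gT}).
Hypothesis psiM : forall i x y, psi i (x * y)%g = psi i x * psi i y.
Hypothesis psi_norm : forall i x, `|psi i x| = 1.
Hypothesis psi_sum : forall x, \sum_i psi i x = (#|gT| * (x == 1%g))%:R.
Hypothesis abG : abelian [set: gT].
Hypothesis symR : R^-1%g = R.

Definition psisum i (Y : {set gT}) : C := \sum_(y in Y) psi i y.

Definition sc_eigenvalue (j : I * bool) : C :=
  psisum j.1 R + (-1) ^+ j.2 * `|psisum j.1 S|.

(* When psi_i(S) = 0, any number of modulus 1 would do. *)
Definition sc_phase i : C :=
  if psisum i S == 0 then 1 else `|psisum i S| / psisum i S.

Definition sc_eigenvector (j : I * bool) (u : gT * bool) : C :=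
  psi j.1 u.1 * (if u.2 then (-1) ^+ j.2 * sc_phase j.1 else 1).

Let psi1 i : psi i 1%g = 1.
Proof.
have p0 : psi i 1%g != 0 by rewrite -normr_gt0 psi_norm.
by apply: (mulfI p0); rewrite -psiM mulg1 mulr1.
Qed.

Let psiV i x : psi i x^-1%g = (psi i x)^*.
Proof.
have p0 : psi i x != 0 by rewrite -normr_gt0 psi_norm.
by apply: (mulfI p0); rewrite -psiM mulgV psi1 -normCK psi_norm expr1n.
Qed.

Let mulGC (x y : gT) : (x * y = y * x)%g.
Proof. by apply: (centsP abG); rewrite inE. Qed.

Lemma sc_phase_norm i : `|sc_phase i| = 1.
Proof.
rewrite /sc_phase; case: eqP => [_|/eqP p0]; first exact: normr1.
by rewrite normf_div normr_id divff // normr_eq0.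
Qed.

Lemma sc_phase_mul i : sc_phase i * psisum i S = `|psisum i S|.
Proof.
rewrite /sc_phase; case: eqP => [->|/eqP p0]; first by rewrite normr0 mulr0.
by rewrite divfK.
Qed.

Lemma sc_phase_mulC i : (psisum i S)^* = sc_phase i * `|psisum i S|.
Proof.
have e : (sc_phase i)^* * (psisum i S)^* = `|psisum i S|.
  by rewrite -rmorphM /= sc_phase_mul conj_Creal ?normr_real.
by rewrite -[in RHS]e mulrA -normCK sc_phase_norm expr1n mul1r.
Qed.

Lemma psisum_translate i (Y : {set gT}) x :
  \sum_y ((y * x^-1)%g \in Y)%:R * psi i y = psi i x * psisum i Y.
Proof.
rewrite (reindex_inj (mulIg x)) mulr_sumr [RHS]big_mkcond /=.
apply: eq_bigr => y _; rewrite mulgK psiM.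
by case: (y \in Y); rewrite ?mul1r ?mul0r // mulrC.
Qed.

(** Seen from copy 1, an edge to copy 0 has its quotient reversed. Substituting [x * y^-1] for [y]
    turns [psi i y] into [psi i x] times a conjugate; commutativity simplifies the membership
    test. *)
Lemma psisum_translateV i (Y : {set gT}) x :
  \sum_y ((x * y^-1)%g \in Y)%:R * psi i y = psi i x * (psisum i Y)^*.
Proof.
rewrite (reindex_inj invg_inj) (reindex_inj (mulIg x^-1%g)) /=.
rewrite rmorph_sum mulr_sumr [RHS]big_mkcond /=.
apply: eq_bigr => y _; rewrite invgK invMg invgK psiM psiV.
have -> : (x * (y * x^-1) = y)%g by rewrite (mulGC x) mulgKV.
by case: (y \in Y); rewrite ?mul1r ?mul0r.
Qed.

Lemma psisum_conj i : (psisum i R)^* = psisum i R.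
Proof.
rewrite rmorph_sum /psisum -[in RHS]symR (reindex_inj invg_inj) /=.
by apply: eq_big => y; rewrite ?inE ?invgK // psiV conjCK.
Qed.

Lemma sc_eigenvalue_real j : sc_eigenvalue j \is Num.real.
Proof.
rewrite rpredD ?rpredM ?normr_real ?rpredX ?rpredN1 //.
by apply/CrealP; apply: psisum_conj.
Qed.

Lemma sum_prod_bool (T : finType) (F : T * bool -> C) :
  \sum_v F v = \sum_x (F (x, false) + F (x, true)).
Proof.
rewrite (eq_bigr (fun v => F (v.1, v.2))) => [|[] //].
rewrite -(pair_bigA _ (fun x b => F (x, b))) /=.
by apply: eq_bigr => x _; rewrite big_bool addrC.
Qed.

(** On copy 0 this reduces to [sc_phase_mul], on copy 1 to its conjugate form [sc_phase_mulC]
    together with the square of the sign being 1. *)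
Lemma sc_eigenvectorP j u :
  \sum_v (semi_cayley R R S u v)%:R * sc_eigenvector j v =
  sc_eigenvalue j * sc_eigenvector j u.
Proof.
case: j u => [i s] [x a]; rewrite sum_prod_bool big_split /=.
rewrite /semi_cayley /sc_eigenvector /sc_eigenvalue /=.
have sumM c (Q : gT -> bool) :
    \sum_y (Q y)%:R * (psi i y * c) = (\sum_y (Q y)%:R * psi i y) * c.
  by rewrite mulr_suml; apply: eq_bigr => y _; rewrite mulrA.
case: a => /=; rewrite !sumM ?psisum_translate ?psisum_translateV.
  rewrite sc_phase_mulC mulr1; have := sqrr_sign C s; set e := (-1) ^+ s => ee.
  by rewrite -[X in psi i x * X]mul1r -ee; ring.
by rewrite -sc_phase_mul; ring.
Qed.

(** This is the completeness form of orthogonality: the sum runs over the eigenvectors, not the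
    vertices. Between different copies the two signs cancel; within one copy the phases cancel and
    the character sum of [x * y^-1] remains. *)
Lemma sc_eigenvector_orthogonal u v :
  \sum_j sc_eigenvector j u * (sc_eigenvector j v)^* =
  (2 * #|gT| * (u == v))%:R.
Proof.
case: u v => [x a] [y b]; rewrite sum_prod_bool /sc_eigenvector /=.
have pp i : psi i x * (psi i y)^* = psi i (x * y^-1)%g by rewrite psiM psiV.
have phaseC i : sc_phase i * (sc_phase i)^* = 1.
  by rewrite -normCK sc_phase_norm expr1n.
have [->|ab] := eqVneq a b; last first.
  rewrite xpair_eqE (negbTE ab) andbF muln0 big1 // => i _.
  case: a b ab => [] [] // _; rewrite !(rmorphM, rmorphN, rmorph1) /=; ring.
rewrite xpair_eqE eqxx andbT eq_mulgV1 -mulnA natrM -psi_sum mulr_sumr.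
apply: eq_bigr => i _; rewrite -pp.
case: b; rewrite !rmorphM ?rmorph1 /= ?rmorph_sign; last by ring.
transitivity (2 * (psi i x * (psi i y)^* * (sc_phase i * (sc_phase i)^*))).
  by ring.
by rewrite phaseC mulr1.
Qed.

Let G0 : (2 * #|gT|)%:R != 0 :> C.
Proof. by rewrite pnatr_eq0 muln_eq0 -lt0n -cardsT cardG_gt0. Qed.

Lemma sum_enum_rank (V : finType) (F : 'I_#|V| -> C) :
  \sum_i F i = \sum_v F (enum_rank v).
Proof. by rewrite (reindex _ (onW_bij _ (@enum_rank_bij V))). Qed.

(** Completeness is the case [k = 0]; each further factor of the matrix acts on an eigenvector. *)
Lemma adjmx_powE k u v :
  (adjmx (semi_cayley R R S) ^+ k) (enum_rank u) (enum_rank v) =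
  (2 * #|gT|)%:R^-1 *
  \sum_j sc_eigenvalue j ^+ k * (sc_eigenvector j u * (sc_eigenvector j v)^*).
Proof.
elim: k u => [|k IHk] u.
  under eq_bigr do rewrite expr0 mul1r.
  rewrite sc_eigenvector_orthogonal [in X in _ * X]natrM mulKf // expr0 !mxE.
  by rewrite (inj_eq enum_rank_inj).
rewrite exprS -mulmxE mxE sum_enum_rank.
under eq_bigr => w _ do rewrite IHk mxE !enum_rankK mulrCA mulr_sumr.
rewrite -mulr_sumr exchange_big /=; congr (_ * _); apply: eq_bigr => j _.
rewrite exprSr -mulrA [sc_eigenvalue j * _]mulrA -sc_eigenvectorP.
by rewrite mulr_suml mulr_sumr; apply: eq_bigr => w _; ring.
Qed.

Lemma eigenvalue_semi_cayley l :
  eigenvalue (adjmx (semi_cayley R R S)) l <-> exists j, l = sc_eigenvalue j.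
Proof.
split=> [/eigenvalueP[x xA x0]|[j ->]]; last first.
  apply/eigenvalueP; exists (\row_k sc_eigenvector j (enum_val k)).
    apply/rowP => k; rewrite !mxE -sc_eigenvectorP sum_enum_rank.
    apply: eq_bigr => v _; rewrite !mxE enum_rankK mulrC.
    by rewrite semi_cayley_sym.
  (* The entry at the identity of copy 0 is 1, so the row is nonzero. *)
  apply/eqP => /rowP/(_ (enum_rank (1%g, false))).
  rewrite !mxE enum_rankK /sc_eigenvector /= psi1 mulr1 => /eqP.
  by rewrite oner_eq0.
(* The coefficients of [x] along the eigenvectors: [c j] vanishes unless [l] is the eigenvalue of
   [j]. *)
pose c j := \sum_u x 0 (enum_rank u) * sc_eigenvector j u.
have cE j : l * c j = sc_eigenvalue j * c j.
  rewrite /c mulr_sumr mulr_sumr.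
  under [RHS]eq_bigr do rewrite mulrCA -sc_eigenvectorP mulr_sumr.
  rewrite exchange_big /=; apply: eq_bigr => v _.
  move/rowP: xA => /(_ (enum_rank v)); rewrite !mxE sum_enum_rank mulrA => <-.
  rewrite mulr_suml; apply: eq_bigr => w _.
  by rewrite mxE !enum_rankK -mulrA.
have [/existsP[k /eqP ->]|] := boolP [exists j, l == sc_eigenvalue j].
  by exists k.
rewrite negb_exists => /forallP nl; case/eqP: x0.
have c0 j : c j = 0.
  apply/eqP; have /eqP := cE j; rewrite -subr_eq0 -mulrBl mulf_eq0 subr_eq0.
  by rewrite (negbTE (nl j)).
apply/rowP => k; rewrite -(enum_valK k); set v := enum_val k.
rewrite [RHS]mxE; apply: (mulIf G0); rewrite mul0r.
(* By completeness this sum is [2 * #|gT|] times the entry of [x] at [v]. *)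
have : \sum_j c j * (sc_eigenvector j v)^* = 0.
  by rewrite big1 // => j _; rewrite c0 mul0r.
under eq_bigr do rewrite mulr_suml.
rewrite exchange_big /= (bigD1 v) //= [X in _ + X]big1 => [|u uv].
  under eq_bigr do rewrite -mulrA.
  by rewrite -mulr_sumr sc_eigenvector_orthogonal eqxx muln1 addr0.
under eq_bigr do rewrite -mulrA.
by rewrite -mulr_sumr sc_eigenvector_orthogonal (negbTE uv) muln0 mulr0.
Qed.

Lemma sum_psisum (Y : {set gT}) : 1%g \notin Y -> \sum_i psisum i Y = 0.
Proof.
move=> Y1; rewrite exchange_big /= big1 // => y yY.
by rewrite psi_sum; case: eqP yY Y1 => [-> ->|]; rewrite ?muln0.
Qed.

(** This is the trace of the adjacency matrix of a graph without loops. *)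
Lemma sum_sc_eigenvalue : 1%g \notin R -> \sum_j sc_eigenvalue j = 0.
Proof.
move=> R1; rewrite sum_prod_bool /sc_eigenvalue /=.
rewrite (eq_bigr (fun i => 2 * psisum i R)) => [|i _]; last by ring.
by rewrite -mulr_sumr sum_psisum ?mulr0.
Qed.

End Spectral.

(** * The matrix exponential, entry by entry *)

Local Open Scope complex_scope.

Definition cis (K : realType) (x : K) : K[i] := (cos x)%:C + 'i * (sin x)%:C.

Section ComplexExponential.
Local Open Scope classical_set_scope.

Lemma cvg_real_complex (K : realType) (u : nat -> K) (a : K) :
  u @ \oo --> a -> (fun n => (u n)%:C : (K[i])^o) @ \oo --> (a%:C : (K[i])^o).
Proof.
move=> ua; apply/cvgrPdist_lt => e e0.
have eR : e = (complex.Re e)%:C by rewrite RRe_real // gtr0_real.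
have re0 : 0 < complex.Re e by move: e0; rewrite {1}eR ltcR.
move/cvgrPdist_lt: ua => /(_ _ re0); apply: filterS => n.
by rewrite -rmorphB /= normc_def /= expr0n /= addr0 sqrtr_sqr {2}eR ltcR.
Qed.

(** Even exponents give cosine terms and odd ones ['i] times sine terms, since ['i ^+ k] is
    [(-1) ^+ k./2], times ['i] when [k] is odd. *)
Lemma exp_coeffE (K : realType) (x : K) (k : nat) :
  (k`!%:R)^-1 * ('i * x%:C) ^+ k =
  (cos_coeff x k)%:C + 'i * (sin_coeff x k)%:C :> K[i].
Proof.
have fE : (k`!%:R : K[i])^-1 = ((k`!%:R : K)^-1)%:C.
  by rewrite fmorphV /= rmorph_nat.
have iE : 'i ^+ k = (if odd k then 'i else 1) * ((-1) ^+ k./2)%:C :> K[i].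
  rewrite rmorphXn /= rmorphN1 -sqr_i -exprM mul2n.
  by rewrite -{1}(odd_double_half k) exprD; case: (odd k);
     rewrite ?expr1 ?expr0.
rewrite fE exprMn iE -rmorphXn /= /cos_coeff /sin_coeff.
case ok: (odd k); rewrite -?complexiE /= ok /=.
  have -> : (k.-1)./2 = k./2.
    by rewrite -[in LHS](odd_double_half k) ok /= doubleK.
  by rewrite !mul0r add0r mul1r !rmorphM /=; ring.
by rewrite !mul0r mulr0 addr0 !mul1r !rmorphM /= -exprnP; ring.
Qed.

Lemma cvg_series_cis (K : realType) (x : K) :
  (series (fun k : nat => (k`!%:R)^-1 * ('i * x%:C) ^+ k : (K[i])^o)) @ \oo
  --> (cis x : (K[i])^o).
Proof.
have -> : series (fun k : nat => (k`!%:R)^-1 * ('i * x%:C) ^+ k : (K[i])^o) =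
  (fun n => (series (cos_coeff x) n)%:C + 'i * (series (sin_coeff x) n)%:C).
  apply/funext => n; rewrite /series /= !rmorph_sum mulr_sumr -big_split /=.
  by apply: eq_bigr => k _; rewrite exp_coeffE.
have cvg_cos : series (cos_coeff x) @ \oo --> cos x.
  by rewrite cos.unlock; exact: is_cvg_series_cos_coeff.
have cvg_sin : series (sin_coeff x) @ \oo --> sin x.
  by rewrite sin.unlock; exact: is_cvg_series_sin_coeff.
apply: cvgD; first exact: cvg_real_complex cvg_cos.
apply: cvgMl_tmp; exact: cvg_real_complex cvg_sin.
Qed.

(** A spectral formula for the powers turns the series of one entry into a finite combination of
    scalar exponential series, whose limits are known. *)
Lemma expmx_scale_entry (K : realType) (n : nat) (A : 'M[K[i]]_n) (J : finType)
    (lam : J -> K) (c : J -> K[i]) (i j : 'I_n) (t : K) :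
  (forall k, (A ^+ k) i j = \sum_x (lam x)%:C ^+ k * c x) ->
  expmx ((- ('i * t%:C)) *: A) i j = \sum_x cis (- (t * lam x)) * c x.
Proof.
move=> A_pow; rewrite mxE.
have scaleX (B : 'M[K[i]]_n) (z : K[i]) k : (z *: B) ^+ k = z ^+ k *: B ^+ k.
  elim: k => [|k IHk]; first by rewrite !expr0 scale1r.
  by rewrite !exprS IHk -!mulmxE -scalemxAl -scalemxAr scalerA.
have -> : series (fun k : nat =>
    (k`!%:R^-1 *: (- ('i * t%:C) *: A) ^+ k) i j : (K[i])^o) =
  (fun m => \sum_x series (fun k : nat =>
     k`!%:R^-1 * ('i * (- (t * lam x))%:C) ^+ k : (K[i])^o) m * c x).
  apply/funext => m; rewrite /series /=.
  under [RHS]eq_bigr do rewrite mulr_suml.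
  rewrite exchange_big /=; apply: eq_bigr => k _.
  rewrite scaleX !mxE A_pow !mulr_sumr; apply: eq_bigr => x _.
  have -> : 'i * (- (t * lam x))%:C = - ('i * t%:C) * (lam x)%:C.
    by rewrite rmorphN rmorphM /=; ring.
  by rewrite [in RHS]exprMn !mulrA.
apply: (@cvg_lim (K[i])^o); first exact: norm_hausdorff.
apply: cvg_big => [|x _]; first by move=> z; exact: add_continuous.
apply: cvgMr_tmp; exact: cvg_series_cis.
Qed.

End ComplexExponential.

(** * The homomorphism [cis] and where it takes the values 1 and -1 *)

Section Cis.
Variable K : realType.
Implicit Types x y : K.

Lemma cis0 : cis 0 = 1 :> K[i].
Proof. by rewrite /cis cos0 sin0 mulr0 addr0. Qed.

Lemma cisD x y : cis (x + y) = cis x * cis y.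
Proof.
rewrite /cis cosD sinD !(rmorphD, rmorphB, rmorphM, rmorphN) /=.
transitivity ((cos x)%:C * (cos y)%:C + 'i ^+ 2 * ((sin x)%:C * (sin y)%:C) +
  'i * ((sin x)%:C * (cos y)%:C + (cos x)%:C * (sin y)%:C)); last by ring.
by rewrite sqrCi mulN1r.
Qed.

Lemma cisE x : cis x = cos x +i* sin x.
Proof. by rewrite /cis -complexiE; simpc. Qed.

Lemma cis_norm x : `|cis x| = 1.
Proof. by rewrite cisE normc_def /= cos2Dsin2 sqrtr1. Qed.

Lemma cis_neq0 x : cis x != 0.
Proof. by rewrite -normr_gt0 cis_norm. Qed.

Lemma cisN x : cis (- x) = (cis x)^-1.
Proof.
by apply: (mulfI (cis_neq0 x)); rewrite -cisD subrr cis0 divff ?cis_neq0.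
Qed.

Lemma cisMz x (k : int) : cis (x * k%:~R) = cis x ^ k.
Proof.
have cisMn n : cis (x * n%:R) = cis x ^+ n.
  elim: n => [|n IHn]; first by rewrite mulr0 cis0 expr0.
  by rewrite -natr1 mulrDr mulr1 cisD IHn exprSr.
case: k => n; first exact: cisMn.
by rewrite NegzE rmorphN /= mulrN cisN -exprnN -cisMn.
Qed.

Lemma cis_eq1 x : cis x = 1 <-> exists k : int, x = 2 * pi * k%:~R.
Proof.
have cis2pi : cis (2 * pi) = 1 :> K[i].
  by rewrite mulrC mulr_natr /cis cos2pi sin2pi mulr0 addr0.
split=> [x1|[k ->]]; last by rewrite cisMz cis2pi exp1rz.
have pi0 := pi_gt0 K.
pose k := Num.floor (x / (2 * pi)); exists k.
have : cis (x - 2 * pi * k%:~R) = 1.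
  by rewrite cisD x1 cisN cisMz cis2pi exp1rz invr1 mulr1.
have : 0 <= x - 2 * pi * k%:~R.
  by rewrite subr_ge0 mulrC -ler_pdivlMr ?floor_le //; lra.
have : x - 2 * pi * k%:~R < 2 * pi.
  rewrite ltrBlDl -[X in _ < _ + X]mulr1 -mulrDr mulrC -ltr_pdivrMr;
    last by lra.
  by have := floorD1_gt (x / (2 * pi)); rewrite intrD.
(* The remainder [y] lies in [[0, 2 * pi)] and has cosine 1; it must be shown to vanish. *)
move: (x - _) (subr_eq0 x (2 * pi * k%:~R)) => y yE y2 y0 y1.
have {}y1 : cos y = 1.
  by move: y1; rewrite cisE => -[->].
apply/eqP; rewrite -yE; apply/eqP.
have [ypi|ypi] := leP y pi.
  by apply: cos_inj; rewrite ?in_itv /= ?y0 ?ypi ?lexx ?(ltW pi0) ?y1 ?cos0.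
(* Beyond [pi], reflection moves [y] into the interval where [cos] is injective; the result
   contradicts [y < 2 * pi]. *)
have : 2 * pi - y = 0.
  apply: cos_inj; rewrite ?in_itv /= ?lexx ?(ltW pi0) //.
    by apply/andP; split; lra.
  rewrite cos0 -[RHS]y1 -[RHS]cosN -[RHS]cosD2pi; congr cos.
  by ring.
by lra.
Qed.

Lemma cis_eqN1 x : cis x = -1 <-> exists k : int, x = pi * (2 * k + 1)%:~R.
Proof.
have cispi : cis pi = - 1 :> K[i].
  by rewrite /cis cospi sinpi mulr0 addr0 rmorphN1.
have -> : cis x = -1 <-> cis (x - pi) = 1.
  rewrite cisD cisN cispi invrN1 mulrN1.
  by split=> [->|/eqP]; rewrite ?opprK // eqr_oppLR => /eqP.
rewrite cis_eq1; split=> -[k xk]; exists k.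
  by rewrite -(subrK pi x) xk intrD intrM; ring.
by rewrite xk intrD intrM; ring.
Qed.

End Cis.

(** * 2-adic valuations of integers *)

Lemma nu2C_int (m : int) :
  nu2C m%:~R = if m == 0 then +oo%E else (logn 2 `|m|%N)%:Z%:E%E.
Proof.
rewrite /nu2C (_ : m%:~R = ratr m%:~R); last by rewrite ratr_int.
rewrite ratCK /nu2 intr_eq0; case: eqP => // _.
by rewrite numq_int denq_int logn1 subr0.
Qed.

Lemma nu2C_int_eq (m k : int) :
  nu2C m%:~R = k%:E%E <-> m != 0 /\ k = (logn 2 `|m|%N)%:Z.
Proof.
rewrite nu2C_int; case: eqP => [->|m0]; first by split=> // -[].
by split=> [[<-]|[_ ->]].
Qed.

Lemma nu2C_int_gt (m : int) (k : nat) :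
  (k%:Z%:E < nu2C m%:~R)%E <-> m = 0 \/ (k < logn 2 `|m|%N)%N.
Proof.
rewrite nu2C_int; case: eqP => [->|m0].
  by rewrite ltry; split=> // _; left.
by rewrite lte_fin ltz_nat; split=> [|[]//]; right.
Qed.

Lemma logn2_odd (m a : int) : m != 0 ->
  logn 2 (absz (m * (2 * a + 1))) = logn 2 `|m|%N.
Proof.
move=> m0; rewrite abszM lognM ?absz_gt0 //; last by lia.
have a_odd : odd (absz (2 * a + 1)) by lia.
by rewrite [X in (_ + X)%N]lognE dvdn2 a_odd !andbF addn0.
Qed.

Lemma Posz_exp2 k : Posz (2 ^ k) = 2 ^+ k.
Proof. by rewrite -natz natrX. Qed.

Lemma logn2_eqP (m : int) (k : nat) :
  m != 0 -> logn 2 `|m|%N = k -> exists q : int, m = 2 ^+ k * (2 * q + 1).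
Proof.
move=> m0 mk; have m1 : (0 < `|m|)%N by rewrite absz_gt0.
have [q] := @pfactor_coprime 2 `|m|%N isT m1; rewrite coprime2n mk => q_odd mE.
have qE : q = (q./2.*2 + 1)%N by rewrite -[LHS]odd_double_half q_odd addnC.
have absE : `|m| = 2 ^+ k * (2 * (q./2)%:Z + 1).
  rewrite -abszE mE {1}qE PoszM Posz_exp2 PoszD -mul2n PoszM; ring.
(* For negative [m] the witness comes from [-(2 * q + 1) = 2 * (- q - 1) + 1]. *)
have [m_ge0|m_lt0] := leP 0 m; [exists (q./2)%:Z | exists (- (q./2)%:Z - 1)].
  by rewrite -absE ger0_norm.
by apply: oppr_inj; rewrite -(ltr0_norm m_lt0) absE; ring.
Qed.

(** The case [m = 0] stands apart because [logn 2 0] is 0, whereas the valuation of 0 is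
    infinite. *)
Lemma ltn_logn2P (m : int) (k : nat) :
  m = 0 \/ (k < logn 2 `|m|)%N <-> exists q : int, m = 2 ^+ k * (2 * q).
Proof.
split=> [[->|km]|[q ->]]; first by exists 0; rewrite !mulr0.
  have m1 : (0 < `|m|)%N by rewrite lt0n; apply: contraTneq km => ->.
  have /dvdnP[q mE] : (2 ^ k.+1 %| `|m|)%N by rewrite pfactor_dvdn.
  exists (sgz m * q%:Z); rewrite [LHS]intEsg mE PoszM Posz_exp2 exprS; ring.
have [->|q0] := eqVneq q 0; first by left; rewrite !mulr0.
right; rewrite -pfactor_dvdn // ?absz_gt0; last first.
  by rewrite !mulf_neq0 ?expf_neq0.
by rewrite !abszM abszX mulnA -expnSr dvdn_mulr.
Qed.

(** * Gcds over finite sets *)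

Lemma gcdn_fsbig_dvdn (T : choiceType) (A : set T) (F : T -> nat) x :
  finite_set A -> A x -> (\big[gcdn/0]_(y \in A) F y %| F x)%N.
Proof. by move=> finA Ax; rewrite (fsbigD1 x) //= dvdn_gcdl. Qed.

Lemma fsbig_gcdn_ind (T : choiceType) (A : set T) (F : T -> nat)
    (P : nat -> Prop) :
  finite_set A -> P 0%N -> (forall m n, P m -> P n -> P (gcdn m n)) ->
  (forall x, A x -> P (F x)) -> P (\big[gcdn/0%N]_(y \in A) F y).
Proof.
move=> finA P0 Pgcd PF; rewrite fsbig_finite // big_seq.
by apply: big_ind => // x; rewrite in_fset_set // inE; exact: PF.
Qed.

(** * Real eigenvalues of the graph and basic facts on the transported characters *)

Section SemiCayley.
(* Conjugation [_^*] is that of closed fields, not the one of complex_scope. *)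
Local Open Scope ring_scope.
Variables (K : realType) (gT : finGroupType) (R S : {set gT}).
Variable psi : Iirr [set: gT] -> gT -> K[i].
Hypothesis abG : abelian [set: gT].
Hypothesis symR : R^-1%g = R.
Hypothesis R1 : 1%g \notin R.
Hypothesis psiM : forall i x y, psi i (x * y)%g = psi i x * psi i y.
Hypothesis psi_norm : forall i x, `|psi i x| = 1.
Hypothesis psi_conj : forall i x, psi (conjC_Iirr i) x = (psi i x)^*.
Hypothesis psi_sum : forall x, \sum_i psi i x = (#|gT| * (x == 1%g))%:R.
Hypothesis psi_rat : forall i (Y : {set gT}) (q : rat),
  (psisum psi i Y == ratr q) = (charsum i Y == ratr q).
Hypothesis psi_rat_norm : forall i (Y : {set gT}) (q : rat),
  (`|psisum psi i Y| == ratr q) = (`|charsum i Y| == ratr q).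

Local Notation Gamma := (semi_cayley R R S).
Local Notation J := (Iirr [set: gT] * bool)%type.
Local Notation evalue := (sc_eigenvalue psi R S).
Local Notation evector := (sc_eigenvector psi S).
Let n := #|gT|.
Let D : K := (#|R| + #|S|)%:R.

Definition sc_lambda (j : J) : K := complex.Re (evalue j).
Local Notation lam := sc_lambda.

Lemma sc_lambdaE j : evalue j = (lam j)%:C.
Proof. by rewrite /sc_lambda RRe_real // sc_eigenvalue_real. Qed.

Lemma psi_chi_rat i x (q : rat) : psi i x = ratr q <-> 'chi_i x = ratr q.
Proof.
have := psi_rat i [set x] q; rewrite /psisum /charsum !big_set1 => e.
by split=> /eqP; [rewrite e|rewrite -e] => /eqP.
Qed.

Lemma psi_chi1 i x : psi i x = 1 <-> 'chi_i x = 1.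
Proof. by have := psi_chi_rat i x 1; rewrite !rmorph1. Qed.

Lemma psi_chiN1 i x : psi i x = -1 <-> 'chi_i x = -1.
Proof. by have := psi_chi_rat i x (-1); rewrite !rmorphN1. Qed.

Lemma psi1 i : psi i 1%g = 1.
Proof. by apply/psi_chi1/lin_char1/char_abelianP. Qed.

Lemma psi0 x : psi 0 x = 1.
Proof. by apply/psi_chi1; rewrite irr0 cfun1E inE. Qed.

Lemma psiX i x m : psi i (x ^+ m)%g = psi i x ^+ m.
Proof.
by elim: m => [|m IHm]; rewrite ?expg0 ?psi1 // expgS psiM IHm exprS.
Qed.

(** Otherwise the sum of the [psi i x] would be both 0 and the order of the group. *)
Lemma psi_eq1P x : (forall i, psi i x = 1) -> x = 1%g.
Proof.
move=> x1; apply/eqP; have := psi_sum x.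
rewrite (eq_bigr (fun=> 1)) // sumr_const card_Iirr_abelian // cardsT.
case: eqP => // _ /eqP; rewrite muln0 pnatr_eq0 -cardsT => /eqP c0.
by have := cardG_gt0 [set: gT]%G; rewrite c0.
Qed.

Lemma psiVM i g h : psi i g * (psi i h)^* = (psi i (g^-1 * h)%g)^*.
Proof.
have -> : psi i h = psi i g * psi i (g^-1 * h)%g by rewrite -psiM mulKVg.
by rewrite rmorphM mulrA -normCK psi_norm expr1n mul1r.
Qed.

Lemma sc_lambda_trivial : lam (0, false) = D.
Proof.
have sum1 Y : psisum psi 0 Y = #|Y|%:R.
  by rewrite /psisum (eq_bigr (fun=> 1)) ?sumr_const // => y _; rewrite psi0.
apply: complexI; rewrite -sc_lambdaE /sc_eigenvalue /= !sum1 mul1r.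
by rewrite normr_nat -natrD rmorph_nat.
Qed.

(** * Transition amplitudes within one copy *)

Lemma transitionE (t : K) u v :
  transition Gamma t u v =
  \sum_j cis (- (t * lam j)) *
    ((2 * n)%:R^-1 * (evector j u * (evector j v)^*)).
Proof.
apply: expmx_scale_entry => k.
rewrite (adjmx_powE R S psiM psi_norm psi_sum abG) mulr_sumr.
by apply: eq_bigr => j _; rewrite sc_lambdaE mulrCA.
Qed.

Lemma card_index : #|{: J}| = (2 * n)%N.
Proof. by rewrite card_prod card_bool card_Iirr_abelian // cardsT mulnC. Qed.

Lemma n2_neq0 : (2 * n)%:R != 0 :> K[i].
Proof. by rewrite pnatr_eq0 muln_eq0 -lt0n /n -cardsT cardG_gt0. Qed.

Lemma norm_transition_eq1 (t : K) g h r :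
  `|transition Gamma t (g, r) (h, r)| = 1 <->
  forall j : J, cis (t * (D - lam j)) = psi j.1 (g^-1 * h)%g.
Proof.
pose F (j : J) := cis (- (t * lam j)) * (psi j.1 (g^-1 * h)%g)^*.
have F1 j : `|F j| = 1 by rewrite normrM cis_norm norm_conjC psi_norm mulr1.
have trE : transition Gamma t (g, r) (h, r) = (2 * n)%:R^-1 * \sum_j F j.
  rewrite transitionE mulr_sumr; apply: eq_bigr => -[i s] _.
  rewrite mulrCA /F /= -psiVM /sc_eigenvector /=; congr (_ * (_ * _)).
  (* On copy 1 the sign squares to 1 and the phase times its conjugate is 1, so both copies give the
     same sum. *)
  case: r; rewrite ?mulr1 // !rmorphM /= rmorph_sign.
  transitivity (psi i g * (psi i h)^* * ((-1) ^+ s ^+ 2 *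
    (sc_phase psi S i * (sc_phase psi S i)^*))); first by ring.
  by rewrite sqrr_sign mul1r -normCK sc_phase_norm expr1n mulr1.
have FE j : F j = cis (- (t * D)) <->
    cis (t * (D - lam j)) = psi j.1 (g^-1 * h)%g.
  rewrite /F; set c := psi _ _; have c1 : c^* * c = 1.
    by rewrite mulrC -normCK psi_norm expr1n.
  have cc : cis (- (t * lam j)) = cis (- (t * D)) * cis (t * (D - lam j)).
    by rewrite -cisD; congr cis; ring.
  split=> [e|e]; last by rewrite cc e -mulrA [c * _]mulrC c1 mulr1.
  apply: (mulfI (cis_neq0 (- (t * D)))).
  by rewrite -cc -e -mulrA c1 mulr1.
have sumF1 : \sum_j `|F j| = (2 * n)%:R.
  by rewrite (eq_bigr (fun=> 1)) // sumr_const card_index.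
rewrite trE normrM normfV normr_nat; split=> [e|e].
  (* Equality case of the triangle inequality: the unit numbers [F j] share one value. At
     [(0, false)] the eigenvalue is [D] and the character is 1, so this value is
     [cis (- (t * D))]. *)
  have := @normC_sum_eq1 _ _ predT F; case=> [||c _ Fc].
  - rewrite sumF1; apply: (mulfI (invr_neq0 n2_neq0)).
    by rewrite e mulVf ?n2_neq0.
  - by [].
  move=> j; apply/FE; rewrite Fc // -(Fc (0, false)) // /F /= psi0 rmorph1.
  by rewrite mulr1 sc_lambda_trivial.
rewrite (eq_bigr (fun=> cis (- (t * D)))) => [|j _]; last by apply/FE.
rewrite sumr_const card_index -[X in `|X|]mulr_natl normrM cis_norm.
by rewrite normr_nat mulr1 mulVf ?n2_neq0.
Qed.

(** * Integrality of eigenvalues and of character sums *)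

Lemma integral_graphE :
  integral_graph K Gamma <-> forall j, exists z : int, lam j = z%:~R.
Proof.
have evP := eigenvalue_semi_cayley S psiM psi_norm psi_sum abG symR.
split=> [int_G j|lam_int l /evP[j ->]].
  have /int_G[z jz] : spectrum Gamma (evalue j) by apply/evP; exists j.
  exists z; apply: complexI; rewrite -sc_lambdaE jz; by rewrite rmorph_int.
by have [z jz] := lam_int j; exists z; rewrite sc_lambdaE jz rmorph_int.
Qed.

Lemma int_charsum_psisum i (Y : {set gT}) (p : int) :
  (charsum i Y = p%:~R <-> psisum psi i Y = p%:~R) /\
  (`|charsum i Y| = p%:~R <-> `|psisum psi i Y| = p%:~R).
Proof.
have := psi_rat i Y p%:~R; have := psi_rat_norm i Y p%:~R; rewrite !ratr_int.
move=> eN e; split; split=> /eqP.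
- by rewrite -e => /eqP.
- by rewrite e => /eqP.
- by rewrite -eN => /eqP.
by rewrite eN => /eqP.
Qed.

Lemma charsum_Aint i (Y : {set gT}) : charsum i Y \in Aint.
Proof. by rewrite rpred_sum // => y _; rewrite Aint_irr. Qed.

Lemma charsum_int i (Y : {set gT}) (q : rat) :
  charsum i Y = ratr q -> charsum i Y \is a Num.int.
Proof. by move=> e; rewrite Cint_rat_Aint ?charsum_Aint // e Crat_rat. Qed.

(** The squared modulus is a rational algebraic integer, hence an integer. The modulus is then a
    root of a monic quadratic over the integers, so being rational it is an integer as well. *)
Lemma norm_charsum_int i (Y : {set gT}) (q : rat) :
  `|charsum i Y| = ratr q -> `|charsum i Y| \is a Num.int.
Proof.
move=> e; have sq_Aint : `|charsum i Y| ^+ 2 \in Aint.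
  by rewrite normCK rpredM // ?Aint_aut charsum_Aint.
have sq_int : `|charsum i Y| ^+ 2 \is a Num.int.
  by rewrite Cint_rat_Aint // e -rmorphXn Crat_rat.
rewrite Cint_rat_Aint ?e ?Crat_rat // -e.
apply: (@root_monic_Aint ('X^2 - (`|charsum i Y| ^+ 2)%:P)).
- by rewrite rootE !hornerE subrr.
- exact: monicXnsubC.
apply/polyOverP => k; rewrite coefB coefXn coefC rpredB ?rpred_nat //.
by case: ifP => _; rewrite ?rpred0.
Qed.

(** Half the sum and half the difference of the two eigenvalues of [i] are [psi_i(R)] and
    [|psi_i(S)|]; their rational values transfer back to [algC]. *)
Lemma rational_sc_lambda :
  (forall j, exists q : rat, lam j = ratr q) ->
  forall i, charsum i R \is a Num.int /\ `|charsum i S| \is a Num.int.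
Proof.
move=> lam_rat i; have [q1 e1] := lam_rat (i, false).
have [q2 e2] := lam_rat (i, true).
have evE b : evalue (i, b) = ratr (if b then q2 else q1).
  by rewrite sc_lambdaE; case: b; rewrite ?e1 ?e2 fmorph_rat.
have := evE true; have := evE false.
rewrite /sc_eigenvalue /= mul1r mulN1r => f1 f2.
have two0 : 2 != 0 :> K[i] by rewrite pnatr_eq0.
split.
  apply: (@charsum_int _ _ ((q1 + q2) / 2)); apply/eqP; rewrite -psi_rat.
  apply/eqP; rewrite rmorphM fmorphV rmorphD rmorph_nat /= -f1 -f2.
  by apply: (mulIf two0); rewrite divfK //; ring.
apply: (@norm_charsum_int _ _ ((q1 - q2) / 2)); apply/eqP.
rewrite -psi_rat_norm; apply/eqP.
rewrite rmorphM fmorphV rmorphB rmorph_nat /= -f1 -f2.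
by apply: (mulIf two0); rewrite divfK //; ring.
Qed.

(** The same integer represents the difference in [K], where times and phases live, and in [algC],
    where the valuations are stated. *)
Lemma int_sc_lambda :
  (forall i, charsum i R \is a Num.int /\ `|charsum i S| \is a Num.int) ->
  exists d : J -> int, forall j : J,
    D - lam j = (d j)%:~R /\
    (#|R| + #|S|)%:R - (charsum j.1 R + (-1) ^+ j.2 * `|charsum j.1 S|)
      = (d j)%:~R :> algC.
Proof.
move=> ch_int.
have ex_d j : exists z : int, D - lam j = z%:~R /\
    (#|R| + #|S|)%:R - (charsum j.1 R + (-1) ^+ j.2 * `|charsum j.1 S|)
      = z%:~R :> algC.
  case: j => i s /=; have [/intrP[p pE] /intrP[q qE]] := ch_int i.
  have := (int_charsum_psisum i R p).1.1 pE.
  have := (int_charsum_psisum i S q).2.1 qE => qE' pE'.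
  exists ((#|R| + #|S|)%:Z - (p + (-1) ^+ s * q)); split; last first.
    by rewrite pE qE !(rmorphB, rmorphD, rmorphM, rmorph_sign).
  apply: complexI; rewrite rmorphB /= -sc_lambdaE /sc_eigenvalue /= pE' qE'.
  by rewrite !(rmorphB, rmorphD, rmorphM, rmorph_sign, rmorph_int, rmorph_nat).
by have [d dP] := choice ex_d; exists d.
Qed.

(** * Rationality forced by a transfer *)

Lemma sum_sc_lambda : \sum_j (D - lam j) = (2 * n)%:R * D.
Proof.
rewrite sumrB sumr_const card_index mulr_natl.
have -> : \sum_j lam j = 0; last by rewrite subr0.
apply: complexI; rewrite rmorph_sum rmorph0 /=.
transitivity (\sum_j evalue j); last exact: sum_sc_eigenvalue.
by apply: eq_bigr => j _; rewrite sc_lambdaE.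
Qed.

Lemma phase_rational (t : K) a :
  0 < t -> (forall j : J, cis (t * (D - lam j)) = psi j.1 a) ->
  forall j, exists q : rat, lam j = ratr q.
Proof.
move=> t0 ta; have pi0 := pi_gt0 K.
(* Raising to the order of [a] makes every phase [psi i a] equal to 1. *)
pose m := #[a]%g; have m0 : 0 < (m%:R : K) by rewrite ltr0n order_gt0.
have ex_k j : exists k : int, t * m%:R * (D - lam j) = 2 * pi * k%:~R.
  apply/cis_eq1; have -> : t * m%:R * (D - lam j) = t * (D - lam j) * m%:~R.
    by rewrite -pmulrn; ring.
  by rewrite cisMz ta -exprnP -psiX expg_order psi1.
have [k kE] := choice ex_k.
pose c := 2 * pi / (t * m%:R).
have tm0 : t * m%:R != 0 by rewrite mulf_neq0 ?gt_eqF.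
have dE j : D - lam j = c * (k j)%:~R.
  by apply: (mulfI tm0); rewrite kE /c mulrA [_ * (_ / _)]mulrC divfK.
have sumk : (2 * n)%:R * D = c * (\sum_j k j)%:~R.
  by rewrite -sum_sc_lambda rmorph_sum mulr_sumr; apply: eq_bigr => j _.
have lamE j : lam j = D - c * (k j)%:~R by rewrite -dE; ring.
have [sk0|sk0] := eqVneq (\sum_j k j) 0; last first.
  (* The trace identity [sumk] can be solved for [c]. *)
  have cE : c = ratr ((2 * n)%:R * (#|R| + #|S|)%:R / (\sum_j k j)%:~R).
    rewrite !rmorphM fmorphV !rmorph_nat rmorph_int sumk mulfK //.
    by rewrite intr_eq0.
  move=> j; rewrite lamE cE.
  exists ((#|R| + #|S|)%:R -
    (2 * n)%:R * (#|R| + #|S|)%:R / (\sum_j k j)%:~R * (k j)%:~R).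
  by rewrite [RHS]rmorphB [in RHS]rmorphM rmorph_int rmorph_nat.
(* A zero sum forces [D = 0], so [R] and [S] are empty and every eigenvalue is 0. *)
have D0 : (#|R| + #|S|)%N = 0%N.
  move/eqP: sumk; rewrite sk0 mulr0 mulf_eq0 !pnatr_eq0 muln_eq0 /=.
  have := cardG_gt0 [set: gT]%G; rewrite cardsT lt0n => /negbTE->.
  by move/eqP.
move/eqP: D0; rewrite addn_eq0 !cards_eq0 => /andP[/eqP R0 /eqP S0].
move=> j; exists 0; apply: complexI; rewrite -sc_lambdaE /sc_eigenvalue.
by rewrite R0 S0 /psisum !big_set0 normr0 mulr0 addr0 !rmorph0.
Qed.

Lemma phase_integral (t : K) a :
  0 < t -> (forall j : J, cis (t * (D - lam j)) = psi j.1 a) ->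
  integral_graph K Gamma /\
  forall i, charsum i R \is a Num.int /\ `|charsum i S| \is a Num.int.
Proof.
move=> t0 /(phase_rational t0)/rational_sc_lambda ch_int; split=> //.
apply/integral_graphE => j; have [d dP] := int_sc_lambda ch_int.
exists ((#|R| + #|S|)%:Z - d j).
by rewrite intrB -(dP j).1 -[X in X - _]/D; ring.
Qed.

Lemma integral_charsum : integral_graph K Gamma ->
  forall i, charsum i R \is a Num.int /\ `|charsum i S| \is a Num.int.
Proof.
move/integral_graphE => lam_int; apply: rational_sc_lambda => j.
by have [z ->] := lam_int j; exists z%:~R; rewrite ratr_int.
Qed.

(** * Signs of the phases and 2-adic valuations *)

Lemma psisum_conjC_Iirr i (Y : {set gT}) :
  psisum psi (conjC_Iirr i) Y = (psisum psi i Y)^*.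
Proof. by rewrite rmorph_sum; apply: eq_bigr => y _; rewrite psi_conj. Qed.

Lemma sc_lambda_conjC i s : lam (conjC_Iirr i, s) = lam (i, s).
Proof.
rewrite /sc_lambda /sc_eigenvalue /= !psisum_conjC_Iirr norm_conjC.
by rewrite (psisum_conj psiM psi_norm symR).
Qed.

(* The eigenvalues of an irreducible character and of its conjugate coincide,
   which forces the phases [psi i a] to be real. *)
Lemma phase_sign (t : K) a :
  (forall j : J, cis (t * (D - lam j)) = psi j.1 a) ->
  forall i, psi i a = 1 \/ psi i a = -1.
Proof.
move=> ta i; have psiC : (psi i a)^* = psi i a.
  have := ta (i, false); have := ta (conjC_Iirr i, false).
  by rewrite sc_lambda_conjC /= psi_conj => -> ->.
have /eqP : psi i a ^+ 2 = 1.
  by rewrite expr2 -[X in _ * X]psiC -normCK psi_norm expr1n.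
by rewrite sqrf_eq1 => /orP[] /eqP; [left|right].
Qed.

Lemma exists_psiN1 a : a != 1%g -> (forall i, psi i a = 1 \/ psi i a = -1) ->
  exists i, psi i a = -1.
Proof.
move=> a1 sgn; apply: contrapT => no; case/eqP: a1; apply: psi_eq1P => i.
by have [//|e] := sgn i; case: no; exists i.
Qed.

(** The phases are signs, so every [psi i] takes the value 1 at the square of [a], which is
    therefore trivial. *)
Lemma phase_order2 (t : K) a : a != 1%g ->
  (forall j : J, cis (t * (D - lam j)) = psi j.1 a) -> #[a]%g = 2%N.
Proof.
move=> a1 /phase_sign sgn; apply: nt_prime_order => //.
apply: psi_eq1P => i; rewrite psiX.
by case: (sgn i) => ->; rewrite ?sqrrN expr1n.
Qed.

Lemma phase_valuation (t : K) a (d : J -> int) :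
  0 < t -> a != 1%g -> (forall j, D - lam j = (d j)%:~R) ->
  (forall j : J, cis (t * (D - lam j)) = psi j.1 a) ->
  exists k : nat, forall j : J,
    (psi j.1 a = -1 -> d j != 0 /\ logn 2 `|d j|%N = k) /\
    (psi j.1 a = 1 -> d j = 0 \/ (k < logn 2 `|d j|%N)%N).
Proof.
move=> t0 a1 dE ta; have pi0 := pi_gt0 K.
have [i0 i0N1] := exists_psiN1 a1 (phase_sign ta).
have odd_phase j : psi j.1 a = -1 ->
    exists k : int, t * (d j)%:~R = pi * (2 * k + 1)%:~R.
  by move=> jN1; apply/cis_eqN1; rewrite -dE ta.
pose j0 : J := (i0, false); have [k0 k0E] := odd_phase j0 i0N1.
have d0 : d j0 != 0.
  apply: contra_eq_neq k0E => ->; rewrite mulr0 eq_sym.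
  by rewrite mulf_neq0 ?intr_eq0 ?(gt_eqF pi0) //; lia.
(* Comparison with the fixed odd multiple at [j0] eliminates [t] and [pi], leaving an identity of
   integers in which the parity of [m] decides the valuation of [d j]. *)
have cross j m : t * (d j)%:~R = pi * m%:~R -> d j * (2 * k0 + 1) = d j0 * m.
  move=> jm; apply: (@intr_inj K); rewrite !intrM.
  have tpi0 : t * pi != 0 by rewrite mulf_neq0 ?gt_eqF.
  apply: (mulfI tpi0).
  transitivity ((t * (d j)%:~R) * (pi * (2 * k0 + 1)%:~R)); first by ring.
  by rewrite jm -k0E; ring.
exists (logn 2 `|d j0|%N) => j; split=> [/odd_phase[k /cross kE]|j1].
  have dj0 : d j != 0.
    have : d j * (2 * k0 + 1) != 0 by rewrite kE mulf_neq0 //; lia.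
    by rewrite mulf_eq0 negb_or => /andP[].
  by split=> //; rewrite -(logn2_odd k0 dj0) kE logn2_odd.
have [k kE] : exists k : int, t * (d j)%:~R = 2 * pi * k%:~R.
  by apply/cis_eq1; rewrite -dE ta.
have {}kE : d j * (2 * k0 + 1) = d j0 * (2 * k).
  by apply: cross; rewrite kE intrM; ring.
have [->|dj0] := eqVneq (d j) 0; first by left.
right; rewrite -(logn2_odd k0 dj0) kE.
have k_neq0 : k != 0.
  apply: contraNneq dj0 => k_eq0; move/eqP: kE.
  by rewrite k_eq0 !mulr0 mulf_eq0 => /orP[//|]; lia.
rewrite !abszM !lognM ?muln_gt0 ?absz_gt0 //.
by rewrite -addn1 leq_add2l.
Qed.

Lemma valuation_phase a (d : J -> int) (k : nat) :
  (forall j, D - lam j = (d j)%:~R) ->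
  (forall i, psi i a = 1 \/ psi i a = -1) ->
  (forall j : J,
    (psi j.1 a = -1 -> d j != 0 /\ logn 2 `|d j|%N = k) /\
    (psi j.1 a = 1 -> d j = 0 \/ (k < logn 2 `|d j|%N)%N)) ->
  forall j : J, cis (pi / 2 ^+ k * (D - lam j)) = psi j.1 a.
Proof.
move=> dE sgn val j.
have two0 : 2 ^+ k != 0 :> K by rewrite expf_neq0 ?pnatr_eq0.
have [|jN1] := sgn j.1 => [j1|]; rewrite ?j1 ?jN1 dE.
  have /ltn_logn2P[q ->] := (val j).2 j1.
  by apply/cis_eq1; exists q; rewrite !intrM rmorphXn /=; field.
have [dj0 /logn2_eqP] := (val j).1 jN1; case=> // q ->.
by apply/cis_eqN1; exists q; rewrite intrM rmorphXn /=; field.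
Qed.

(** * Periodicity and the minimum period *)

(** This is the case [a = 1]. The condition does not mention [u], so all vertices have the same
    periods. *)
Lemma periodic_atE (t : K) u :
  periodic_at Gamma t u <-> forall j, cis (t * (D - lam j)) = 1.
Proof.
case: u => g r; rewrite /periodic_at norm_transition_eq1 mulVg.
by split=> ta j; rewrite ta psi1.
Qed.

Lemma periodic_graphE : periodic_graph K Gamma <-> integral_graph K Gamma.
Proof.
split=> [[t t0 /(_ (1%g, false))/periodic_atE ta]|int_G].
  by apply: (proj1 (@phase_integral t 1%g t0 _)) => j; rewrite ta psi1.
exists (2 * pi) => [|u]; first by rewrite mulr_gt0 ?pi_gt0.
have [d dP] := int_sc_lambda (integral_charsum int_G).
by apply/periodic_atE => j; apply/cis_eq1; exists (d j); rewrite (dP j).1.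
Qed.

Lemma semi_cayley_minimum_period (u : gT * bool) :
  let lambda1 : K[i] := (#|R| + #|S|)%:R in
  integral_graph K Gamma -> (spectrum Gamma `\ lambda1 !=set0)%classic ->
  minimum_period Gamma
    (2 * pi / (gcd_diff (spectrum Gamma `\ lambda1)%classic lambda1)%:R : K) u.
Proof.
move=> lambda1 int_G [l0 [l0_spec /eqP l0_neq]].
have evP := eigenvalue_semi_cayley S psiM psi_norm psi_sum abG symR.
have [d dP] := int_sc_lambda (integral_charsum int_G).
have dE j : D - lam j = (d j)%:~R := (dP j).1.
have diffE j : evalue j - lambda1 = (- d j)%:~R.
  rewrite sc_lambdaE rmorphN /= -(rmorph_int (@real_complex K)) -dE.
  by rewrite rmorphB /= rmorph_nat; ring.
pose Z := [set z : int |
  exists2 l, (spectrum Gamma `\ lambda1)%classic l &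
    l - lambda1 = z%:~R]%classic.
have ZP z : Z z <-> exists2 j, z = - d j & d j != 0.
  split=> [[l [/evP[j ->] /eqP lj]]|[j -> dj]].
    rewrite diffE => /intr_inj <-; exists j => //.
    apply: contra_neq lj => dj; apply/eqP; rewrite -subr_eq0 diffE dj.
    by rewrite oppr0.
  exists (evalue j); last exact: diffE.
  split; first by apply/evP; exists j.
  by move=> /eqP; rewrite -subr_eq0 diffE intr_eq0 oppr_eq0 (negbTE dj).
have finZ : finite_set Z.
  apply: (@sub_finite_set _ _ [set` [seq - d j | j <- enum {: J}]]%classic).
    by move=> z /ZP[j -> _]; apply: (map_f (fun j => - d j)); rewrite mem_enum.
  exact: finite_seq.
rewrite /gcd_diff -/Z; set M := \big[_/_]_(_ \in _) _.
have M_dvd j : exists q : int, d j = M%:Z * q.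
  have [->|dj] := eqVneq (d j) 0; first by exists 0; rewrite mulr0.
  have Zj : Z (- d j) by apply/ZP; exists j.
  have /= := gcdn_fsbig_dvdn (fun z : int => `|z|%N) finZ Zj.
  rewrite -/M abszN => /dvdnP[q qE]; exists (sgz (d j) * q%:Z).
  by rewrite [LHS]intEsg qE PoszM; ring.
(* The eigenvalue [l0] contributes a nonzero difference, so the gcd is not the default 0. *)
have M_gt0 : 0 < M%:R :> K.
  have /evP[j jE] := l0_spec; have [q dq] := M_dvd j.
  rewrite ltr0n lt0n; apply: contra_neq l0_neq => M0.
  by apply/eqP; rewrite -subr_eq0 jE diffE dq M0 mul0r oppr0.
have pi0 := pi_gt0 K; split.
- by rewrite divr_gt0 ?mulr_gt0.
- apply/periodic_atE => j; apply/cis_eq1; have [q dq] := M_dvd j; exists q.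
  by rewrite dE dq intrM -pmulrn; field; rewrite gt_eqF.
move=> t t0 /periodic_atE ta.
(* The integers [m] with [t * m] in [2 * pi] times the integers are closed under gcd by Bezout, and
   contain every [d j] up to sign. *)
have [k kE] : exists k : int, t * M%:R = 2 * pi * k%:~R.
  apply: (@fsbig_gcdn_ind _ Z _ (fun m : nat => exists k : int,
    t * m%:R = 2 * pi * k%:~R) finZ).
  - by exists 0; rewrite !mulr0.
  - move=> m1 m2 [k1 e1] [k2 e2].
    have [a [b ab]] := Bezoutz m1%:Z m2%:Z; exists (a * k1 + b * k2).
    have : (gcdn m1 m2)%:R = (a * m1%:Z + b * m2%:Z)%:~R :> K.
      by rewrite ab.
    rewrite intrD !intrM -!pmulrn => ->.
    transitivity (a%:~R * (t * m1%:R) + b%:~R * (t * m2%:R)); first by ring.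
    by rewrite e1 e2 intrD !intrM; ring.
  move=> z /ZP[j -> _]; rewrite abszN.
  have /cis_eq1[k kE] := ta j; exists (sgz (d j) * k).
  rewrite intrM mulrCA -kE dE mulrCA; congr (_ * _).
  by rewrite -intrM -abszEsg.
(* As [t * M] is positive, the integer [k] is at least 1. *)
rewrite ler_pdivrMr // kE ler_peMr //; first by rewrite mulr_ge0 // ltW.
rewrite -[1]/(1%:~R) ler_int -gtz0_ge1 -(ltr0z K).
have : 0 < t * M%:R by rewrite mulr_gt0.
by rewrite kE pmulr_rgt0 // mulr_gt0.
Qed.

(** * The criterion for perfect state transfer *)

Lemma pst_semi_cayley (g h : gT) (r : bool) :
  let a := (g^-1 * h)%g in
  let deg : algC := (#|R| + #|S|)%:R in
  a != 1%g ->
  pst K Gamma (g, r) (h, r) <->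
  [/\ #[a]%g = 2%N,
      integral_graph K Gamma /\
      (forall i, charsum i R \is a Num.int /\ `|charsum i S| \is a Num.int)
    & exists k : int,
        (forall i : Iirr [set: gT], 'chi_i a = -1 ->
           nu2C (deg - lambda_plus R S i) = k%:E%E /\
           nu2C (deg - lambda_minus R S i) = k%:E%E) /\
        (forall i : Iirr [set: gT], 'chi_i a = 1 ->
           (k%:E < nu2C (deg - lambda_plus R S i)%R)%E /\
           (k%:E < nu2C (deg - lambda_minus R S i)%R)%E)].
Proof.
move=> a deg a1.
have degE d : (forall j : J,
      D - lam j = (d j)%:~R /\
      deg - (charsum j.1 R + (-1) ^+ j.2 * `|charsum j.1 S|) = (d j)%:~R) ->
    (forall j, D - lam j = (d j)%:~R) /\ forall i,
      deg - lambda_plus R S i = (d (i, false))%:~R /\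
      deg - lambda_minus R S i = (d (i, true))%:~R.
  move=> dP; split=> [j|i]; first exact: (dP j).1.
  by rewrite -(dP (i, false)).2 -(dP (i, true)).2 /= mul1r mulN1r.
split=> [[t t0 /norm_transition_eq1 ta]|[a2 [int_G ch_int] [k [kN1 k1]]]].
  have [int_G ch_int] := phase_integral t0 ta.
  have [d /degE[dE dC]] := int_sc_lambda ch_int.
  have [k kP] := phase_valuation t0 a1 dE ta.
  split; [exact: phase_order2 a1 ta | by split |].
  exists k%:Z; split=> i; have [-> ->] := dC i.
    move=> /psi_chiN1 iN1; split; apply/nu2C_int_eq.
      by have [-> ->] := (kP (i, false)).1 iN1.
    by have [-> ->] := (kP (i, true)).1 iN1.
  by move=> /psi_chi1 i1; split; apply/nu2C_int_gt; apply: (kP (i, _)).2.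
have [d /degE[dE dC]] := int_sc_lambda ch_int.
have sgn i : psi i a = 1 \/ psi i a = -1.
  have /eqP : psi i a ^+ 2 = 1 by rewrite -psiX -a2 expg_order psi1.
  by rewrite sqrf_eq1 => /orP[] /eqP; [left|right].
(* A character with value -1 at [a] identifies the integer [k] with the natural number [logn 2] of a
   nonzero [d j], so the time [pi / 2 ^+ k] makes sense. *)
have [i0 i0N1] := exists_psiN1 a1 sgn.
have [] := kN1 i0 ((psi_chiN1 _ _).1 i0N1).
rewrite (dC i0).1 => /nu2C_int_eq[_ kE] _; rewrite kE in kN1 k1.
set m := logn 2 _ in kN1 k1.
exists (pi / 2 ^+ m).
  by rewrite divr_gt0 ?pi_gt0 ?exprn_gt0.
apply/norm_transition_eq1/valuation_phase => // -[i s] /=.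
split=> [/psi_chiN1/kN1|/psi_chi1/k1]; have [-> ->] := dC i.
  by case: s => -[/nu2C_int_eq[? [?]] /nu2C_int_eq[? [?]]].
by case: s => -[/nu2C_int_gt ? /nu2C_int_gt ?].
Qed.

End SemiCayley.

Theorem theorem1 (K : realType) (gT : finGroupType) (R S : {set gT})
    (abG : abelian [set: gT]) (symR : R^-1%g = R) (R1 : 1%g \notin R) :
  let Gamma := semi_cayley R R S in
  let lambda1 : K[i] := (#|R| + #|S|)%:R in
  let deg : algC := (#|R| + #|S|)%:R in
  [/\ forall (g h : gT) (r s : bool),
        let a := (g^-1 * h)%g in
        r = s -> (g, r) != (h, s) ->
        (pst K Gamma (g, r) (h, s) <->
         [/\ #[a]%g = 2%N,
             integral_graph K Gamma /\
             (forall i : Iirr [set: gT],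
                charsum i R \is a Num.int /\ `|charsum i S| \is a Num.int)
           & exists k : int,
               (forall i : Iirr [set: gT], 'chi_i a = -1 ->
                  nu2C (deg - lambda_plus R S i) = k%:E%E /\
                  nu2C (deg - lambda_minus R S i) = k%:E%E) /\
               (forall i : Iirr [set: gT], 'chi_i a = 1 ->
                  (k%:E < nu2C (deg - lambda_plus R S i)%R)%E /\
                  (k%:E < nu2C (deg - lambda_minus R S i)%R)%E)]),
      periodic_graph K Gamma <-> integral_graph K Gamma
    & integral_graph K Gamma -> (spectrum Gamma `\ lambda1 !=set0)%classic ->
      forall u : gT * bool,
        minimum_period Gamma
          (2 * pi / (gcd_diff (spectrum Gamma `\ lambda1)%classic lambda1)%:R : K)
          u].
Proof.
move=> Gamma lambda1 deg.
have [psi [psiM [psi_norm psi_conj] psi_sum psi_rat psi_rat_norm]] :=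
  conjugate_characters K[i] abG.
split.
- move=> g h r s a <- gh; apply: (@pst_semi_cayley _ _ _ _ psi) => //.
  (* Distinct vertices of one copy have distinct group elements, so [a] is not 1. *)
  apply: contra_neq gh => ga; congr (_, _).
  by rewrite -[RHS](mulKVg g) ga mulg1.
- exact: (@periodic_graphE _ _ _ _ psi).
by move=> int_G G_neq u; apply: (@semi_cayley_minimum_period _ _ _ _ psi).
Qed.
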